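(* Let $X=\{X_n:n\ge 0\}$ be a (time-homogeneous) Markov chain with state space $W$. Suppose there exist measurable sets $F\subset G\subset W$, a measurable function $g:W\to[0,\infty)$, and constants $c\in[0,1)$, $\delta>0$, and finite $b$ and $\tilde b$ such that (A) $\mathbb{E}_x[g(X_1)]\le c\,g(x)$ for all $x\in G$; (B) $g(x)\ge b$ for all $x\in G^c$; (C) $g(x)\le\tilde b<b$ for all $x\in F$; (D) $\mathbb{P}_x(X_2\in F)\ge\delta$ for all $x\in W$. Then there exists $\theta>1$ such that $\theta^n g(X_n)\to 0$ almost surely as $n\to\infty$.
   Context: $W$ is a general (measurable) state space; $\mathbb{P}_x$ and $\mathbb{E}_x$ denote probability and expectation for the chain given $X_0=x$; $G^c=W\setminus G$. *)

(* Defs.v *)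
From HB Require Import structures.
From mathcomp Require Export all_boot all_order all_algebra.
From mathcomp Require Export all_classical all_reals all_analysis.
Export Order.TTheory GRing.Theory Num.Theory.
Export numFieldNormedType.Exports.

Set Implicit Arguments.
Unset Strict Implicit.
Unset Printing Implicit Defensive.

Local Open Scope classical_set_scope.
Local Open Scope ring_scope.
Local Open Scope ereal_scope.

(* The sigma-algebra generated by X_0, ..., X_n. *)
Definition history d (Omega : measurableType d) d' (W : measurableType d')
    (X : nat -> Omega -> W) (n : nat) : set (set Omega) :=
  <<s \bigcup_(i in [set i | (i <= n)%N])
        preimage_set_system setT (X i) measurable >>.

(* Under P, with an arbitrary initial law, X is a time-homogeneous Markov chain
   with one-step transition kernel K: the equation below says that K (X n) B is
   a version of P(X_{n+1} \in B | X_0, ..., X_n). *)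
Definition markov_chain d (Omega : measurableType d) d' (W : measurableType d')
    (R : realType) (K : R.-pker W ~> W) (P : probability Omega R)
    (X : nat -> Omega -> W) : Prop :=
  (forall n, measurable_fun setT (X n)) /\
  (forall n E B, history X n E -> measurable B ->
     P (E `&` X n.+1 @^-1` B) = \int[P]_(w in E) K (X n w) B).

(* [Pr x] is the law usually written P_x. Singletons of W need not be
   measurable, so X_0 = x is expressed by: the law of X_0 under P_x is the
   Dirac mass at x. *)
Definition markov_family d (Omega : measurableType d) d' (W : measurableType d')
    (R : realType) (K : R.-pker W ~> W) (Pr : W -> probability Omega R)
    (X : nat -> Omega -> W) : Prop :=
  forall x : W, markov_chain K (Pr x) X /\
    (forall A, measurable A -> Pr x (X 0%N @^-1` A) = \d_x A).

(* Main.v *)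
(** Write K f (x) for the integral of f against K x, put v = min (1, g / b) and
    p = 1 - b' / b > 0. By (A) and (B), v >= 1 off G and K v <= v on G, so the
    conditional probability that X ever leaves G after time m is at most
    v (X_m); by (C), v + p 1_F <= 1, and integrating twice with (D) gives
    K (K v) <= rho := 1 - delta p < 1. So, given X_0, ..., X_m, the chain leaves
    G at some time >= m + 2 with probability at most rho. Hence the event L that
    X is outside G infinitely often satisfies P (E `&` L) <= rho P E for every E
    depending on finitely many coordinates; approximating L itself by such
    events yields P L <= rho P L, i.e. P L = 0.

    On the event that X stays in G from time m on and g (X_m) <= k, condition (A)
    bounds the expectation of g (X_{m+n}) by k c^n, so theta^n g (X_{m+n}) has a
    summable sequence of expectations as soon as theta c < 1. These events, for
    m and k in nat, cover the complement of L. *)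

Require Import Defs.
From mathcomp Require Import measurable_realfun.

Set Implicit Arguments.
Unset Strict Implicit.
Unset Printing Implicit Defensive.

Local Open Scope classical_set_scope.
Local Open Scope ring_scope.
Local Open Scope ereal_scope.

(** * Disintegration: from indicators to nonnegative functions *)

Section transfer.
Context d d' (T : measurableType d) (U : measurableType d') (R : realType).
Variables (mu : {measure set T -> \bar R}) (D : set T) (phi : T -> U).
Variable k : T -> {measure set U -> \bar R}.
Hypothesis mD : measurable D.
Hypothesis mphi : measurable_fun setT phi.
Hypothesis mk : forall B, measurable B -> measurable_fun [set: T] (k ^~ B).
Hypothesis phik : forall B, measurable B ->
  mu (D `&` phi @^-1` B) = \int[mu]_(w in D) k w B.

Import HBNNSimple.

(** [phik] is the case of an indicator, and both sides are additive over the finitely many fibres of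
    [h]. *)
Lemma integral_disintegration_nnsfun (h : {nnsfun U >-> R}) :
  \int[mu]_(w in D) (h (phi w))%:E = \int[mu]_(w in D) \int[k w]_y (h y)%:E.
Proof.
have mh r : measurable (h @^-1` [set r]) by [].
have mkh r : measurable_fun D (fun w => k w (h @^-1` [set r])).
  exact: measurable_funTS (mk (mh r)).
transitivity (\sum_(r \in range h) (r%:E * mu (D `&` phi @^-1` (h @^-1` [set r])))).
  under eq_integral do rewrite fimfunE -fsumEFin//.
  rewrite ge0_integral_fsum//; last 2 first.
  - move=> r; apply/measurable_EFinP/measurable_funTS.
    apply: measurable_funM => //.
    exact: (measurableT_comp _ mphi).
  - by move=> r z _; rewrite EFinM nnfun_muleindic_ge0.
  apply: eq_fsbigr => r /[!inE] -[x _ <-].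
  under eq_integral do rewrite EFinM.
  rewrite ge0_integralZl_EFin//.
  - rewrite (_ : (fun w => _) = (fun w => (\1_(phi @^-1` (h @^-1` [set h x])) w)%:E))//.
    rewrite integral_indic//; first by rewrite setIC.
    by rewrite -[X in measurable X]setTI; exact: mphi.
  - by apply/measurable_EFinP/measurable_funTS; exact: (measurableT_comp _ mphi).
transitivity (\int[mu]_(w in D) \sum_(r \in range h) (r%:E * k w (h @^-1` [set r]))).
  rewrite ge0_integral_fsum//; last 2 first.
  - by move=> r; exact: measurable_funeM.
  (* For negative [r] the fibre of the nonnegative [h] is empty, so the summand is zero. *)
  - move=> r w _.
    have := mulemu_ge0 (fun r => h @^-1` [set r]).
    by apply; exact: preimage_nnfun0.
  apply: eq_fsbigr => r /[!inE] -[x _ <-].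
  by rewrite phik// ge0_integralZl_EFin.
apply: eq_integral => w _.
by rewrite integralT_nnsfun sintegralE.
Qed.

(** Simple functions increase to [f]; monotone convergence is used on the left, against each [k w],
    and for the outer integral on the right. *)
Lemma integral_disintegration (f : U -> \bar R) :
  (forall y, 0 <= f y) -> measurable_fun setT f ->
  \int[mu]_(w in D) f (phi w) = \int[mu]_(w in D) \int[k w]_y f y.
Proof.
move=> f0 mf; pose f_ := nnsfun_approx measurableT mf.
have f_ge0 n y : 0 <= (f_ n y)%:E by rewrite lee_fin.
have f_le y : {homo (fun n => (f_ n y)%:E) : m n / (m <= n)%N >-> m <= n}.
  by move=> m n mn; rewrite lee_fin; exact/lefP/nd_nnsfun_approx.
have mf_ n : measurable_fun setT (EFin \o f_ n) by exact/measurable_EFinP.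
have f_lim y : limn (fun n => (f_ n y)%:E) = f y.
  by apply/cvg_lim => //; exact: cvg_nnsfun_approx.
transitivity (\int[mu]_(w in D) limn (fun n => (f_ n (phi w))%:E)).
  by apply: eq_integral => w _; rewrite f_lim.
rewrite monotone_convergence//; last by
  move=> n; apply: measurable_funTS; exact: (measurableT_comp (mf_ n)).
under eq_fun do rewrite integral_disintegration_nnsfun.
rewrite -monotone_convergence//.
- apply: eq_integral => w _; rewrite -monotone_convergence//.
  by apply: eq_integral => y _; rewrite f_lim.
- move=> n; apply: measurable_funTS.
  by apply: (measurable_fun_integral_kernel mk) => //; exact: mf_.
- by move=> n w _; apply: integral_ge0 => y _; exact: f_ge0.
- move=> w _ m n mn; apply: ge0_le_integral => // [||y _].
  + exact: mf_.
  + exact: mf_.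
  + exact: f_le.
Qed.

End transfer.

(** The sum of the [f n] has integral at most [C / (1 - q)], so it is finite almost everywhere, and
    the terms of a convergent series tend to zero. *)
Lemma ae_cvg0_geometric d (T : measurableType d) (R : realType)
    (mu : {measure set T -> \bar R}) (f : nat -> T -> R) (C q : R) :
  (0 <= C)%R -> (0 <= q < 1)%R ->
  (forall n, measurable_fun setT (f n)) -> (forall n w, (0 <= f n w)%R) ->
  (forall n, \int[mu]_w (f n w)%:E <= (C * q ^+ n)%:E) ->
  {ae mu, forall w, f ^~ w @ \oo --> (0 : R)%R}.
Proof.
move=> C0 /andP[q0 q1] mf f0 If.
have f0E n w : 0 <= (f n w)%:E by rewrite lee_fin.
have mfE n : measurable_fun setT (fun w => (f n w)%:E) by exact/measurable_EFinP.
pose S w := \sum_(n <oo) (f n w)%:E.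
have S0 w : 0 <= S w by exact: nneseries_ge0.
have Soo : \int[mu]_w S w < +oo.
  rewrite integral_nneseries//.
  apply: (@le_lt_trans _ _ (C * (1 - q)^-1)%:E); last by rewrite ltry.
  apply: lime_le.
    by apply: is_cvg_nneseries => n _ _; exact: integral_ge0.
  apply: nearW => n; apply: (@le_trans _ _ (series (geometric C q) n)%:E).
    by rewrite /series/= -sumEFin; apply: lee_sum => i _; exact: If.
  rewrite lee_fin geometric_seriesE ?lt_eqF//= ler_pM2r ?invr_gt0 ?subr_gt0//.
  by rewrite ler_piMr// lerBlDr lerDl exprn_ge0.
have iS : mu.-integrable setT S.
  apply/integrableP; split; first exact: ge0_emeasurable_sum.
  by under eq_integral do rewrite gee0_abs//.
apply: filterS (integrable_ae measurableT iS) => w /(_ Logic.I) Sfin.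
have Sw : S w < +oo by rewrite ltey_eq Sfin.
apply: (@fine_cvg _ _ _ _ (fun n => (f n w)%:E)).
(* The term of index [N] lies between zero and the tail of the series that starts at [N]. *)
apply: (squeeze_cvge _ (cvg_cst 0) (nneseries_tail_cvg Sw _)) => //.
apply: nearW => N; rewrite f0E/=.
rewrite (nneseries_split N 1)// addn1 big_nat1.
by rewrite leeDl// nneseries_ge0.
Qed.

(** * Events determined by finitely many coordinates *)

Section history.
Context d (Omega : measurableType d) d' (W : measurableType d').
Variable X : nat -> Omega -> W.

Lemma history_preimage m n B : (m <= n)%N -> measurable B ->
  history X n (X m @^-1` B).
Proof.
move=> mn mB; apply: sub_sigma_algebra; exists m => //.
by exists B; rewrite ?setTI.
Qed.

Lemma history_le m n : (m <= n)%N -> history X m `<=` history X n.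
Proof.
move=> mn; apply: sub_sigma_algebra2 => E [i /= im ?].
by exists i => //=; exact: leq_trans mn.
Qed.

Lemma history_measurable n : (forall i, measurable_fun setT (X i)) ->
  history X n `<=` measurable.
Proof.
move=> mX; apply: smallest_sub; first exact: sigma_algebra_measurable.
by move=> E [i _ [B mB <-]]; exact: mX.
Qed.

Lemma history0 n : history X n set0.
Proof. exact: sigma_algebra0. Qed.

Lemma historyI n E E' : history X n E -> history X n E' ->
  history X n (E `&` E').
Proof.
exact: (@measurableI _ (g_sigma_algebraType (\bigcup_(i in [set i | (i <= n)%N])
  preimage_set_system setT (X i) measurable))).
Qed.

Lemma historyU n E E' : history X n E -> history X n E' ->
  history X n (E `|` E').
Proof.
exact: (@measurableU _ (g_sigma_algebraType (\bigcup_(i in [set i | (i <= n)%N])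
  preimage_set_system setT (X i) measurable))).
Qed.

End history.

(** * The Markov property for nonnegative functions *)

Section markov.
Context d (Omega : measurableType d) d' (W : measurableType d') (R : realType).
Variables (K : R.-pker W ~> W) (P : probability Omega R) (X : nat -> Omega -> W).
Hypothesis HX : markov_chain K P X.

Let mX n : measurable_fun setT (X n). Proof. exact: HX.1. Qed.

Lemma markov_chain_integral n E (f : W -> \bar R) : history X n E ->
  (forall y, 0 <= f y) -> measurable_fun setT f ->
  \int[P]_(w in E) f (X n.+1 w) = \int[P]_(w in E) \int[K (X n w)]_y f y.
Proof.
move=> hE f0 mf; apply: (integral_disintegration (k := fun w => K (X n w))) => //.
- exact: history_measurable hE.
- by move=> B mB; apply: (measurableT_comp (measurable_kernel K _ mB)).
- by move=> B mB; exact: HX.2.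
Qed.

Lemma measurable_kernel_integral (f : W -> \bar R) : (forall y, 0 <= f y) ->
  measurable_fun setT f -> measurable_fun setT (fun x => \int[K x]_y f y).
Proof.
move=> f0 mf; apply: measurable_fun_integral_kernel => // B mB.
exact: measurable_kernel.
Qed.

(** * Exits from [G] and decay inside [G] *)

Variable G : set W.
Hypothesis mG : measurable G.

(** The window of [n] times is finite, so the event lies in a single [history]. The union over [n],
    then the intersection over [m], give infinitely many visits to the complement of [G]. *)
Definition exits (m n : nat) : set Omega :=
  \bigcup_(i < n) X (m + i)%N @^-1` (~` G).

Lemma exitsS m n : exits m n.+1 = X m @^-1` (~` G) `|` exits m.+1 n.
Proof.
apply/seteqP; split => w.
- move=> [[|i] /= ? ?]; first by left; rewrite -[m]addn0.
  by right; exists i => //=; rewrite addSnnS.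
- move=> [/= Gc|[i /= ? ?]]; first by exists 0%N => //=; rewrite addn0.
  by exists i.+1 => //=; rewrite -addSnnS.
Qed.

Lemma exits0 m : exits m 0 = set0.
Proof. by rewrite /exits bigcup_mkord big_ord0. Qed.

(** The last time inspected is [m + n - 1]; the bound is written without subtraction. *)
Lemma exits_history m n k : (m + n <= k.+1)%N -> history X k (exits m n).
Proof.
elim: n m => [|n IHn] m mnk; first by rewrite exits0; exact: history0.
rewrite exitsS; apply: historyU; last by apply: IHn; rewrite addSnnS.
apply: history_preimage; last exact: measurableC.
by rewrite addnS ltnS in mnk; rewrite (leq_trans _ mnk)// leq_addr.
Qed.

Lemma measurable_exits m n : measurable (exits m n).
Proof.
by apply: (@history_measurable _ _ _ _ _ (m + n)) => //; exact: exits_history.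
Qed.

Lemma subset_exits m n k : (n <= k)%N -> exits m n `<=` exits m k.
Proof. by move=> nk w [i /= ik ?]; exists i => //=; exact: leq_trans nk. Qed.

(** A maximal inequality for [v] along the chain stopped on leaving [G], by induction on the window.
    [E] is arbitrary because the induction restarts at time [m + 1] from the event [E2]. *)
Lemma prob_exits_le (v : W -> \bar R) : (forall x, 0 <= v x) ->
    measurable_fun setT v -> (forall x, ~ G x -> 1 <= v x) ->
    (forall x, G x -> \int[K x]_y v y <= v x) ->
  forall n m E, history X m E ->
  P (E `&` exits m n) <= \int[P]_(w in E) v (X m w).
Proof.
move=> v0 mv v1 Kv; elim=> [|n IHn] m E hE.
  by rewrite exits0 setI0 measure0 integral_ge0.
have mE := history_measurable mX hE.
have mvX k D : measurable_fun D (v \o X k).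
  by apply: measurable_funTS; exact: measurableT_comp.
have mpre k B : measurable B -> measurable (X k @^-1` B).
  by move=> mB; rewrite -[X in measurable X]setTI; exact: mX.
(* On [E1] the exit is immediate and [v] is at least 1; on [E2] it comes at time [m + 1] or later,
   and [Kv] brings the bound back to time [m]. *)
set E1 := E `&` X m @^-1` (~` G); set E2 := E `&` X m @^-1` G.
have mE1 : measurable E1 by apply: measurableI => //; apply/mpre/measurableC.
have mE2 : measurable E2 by apply: measurableI => //; exact: mpre.
have hE2 : history X m E2 by apply: historyI => //; exact: history_preimage.
have E12 : E1 `|` E2 = E.
  by rewrite -setIUr -preimage_setU setUC setUv preimage_setT setIT.
rewrite -{2}E12 ge0_integral_setU//; last 2 first.
- exact: mvX.
- apply/disj_setPS => w [[_ /= ?] []] //.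
apply: (@le_trans _ _ (P (E1 `|` (E2 `&` exits m.+1 n)))).
  apply: le_measure; rewrite ?inE.
  - by apply: measurableI => //; exact: measurable_exits.
  - by apply: measurableU => //; apply: measurableI => //; exact: measurable_exits.
  - rewrite exitsS => w [Ew] [Gw|Xw]; first by left.
    by have [Gw|Gw] := pselect (G (X m w)); [right|left].
apply: le_trans (measureU2 _ _ _) _ => //.
  by apply: measurableI => //; exact: measurable_exits.
apply: leeD.
  rewrite -[leLHS]mul1e -integral_cst//.
  apply: ge0_le_integral => //; first exact: mvX.
  by move=> w [_]; exact: v1.
apply: le_trans (IHn _ _ (history_le (leqnSn m) hE2)) _.
rewrite markov_chain_integral//; apply: ge0_le_integral => //.
- by move=> w _; exact: integral_ge0.
- apply: measurable_funTS.
  exact: (measurableT_comp (measurable_kernel_integral v0 mv) (mX m)).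
- exact: mvX.
- by move=> w [_]; exact: Kv.
Qed.

(** The exit bound at time [m + 2] is pulled back to time [m] by two uses of the Markov property,
    which produce the double integral bounded by [rho]. *)
Lemma prob_exits2_le (v : W -> \bar R) (rho : R) : (forall x, 0 <= v x) ->
    measurable_fun setT v -> (forall x, ~ G x -> 1 <= v x) ->
    (forall x, G x -> \int[K x]_y v y <= v x) ->
    (forall x, \int[K x]_y \int[K y]_z v z <= rho%:E) ->
  forall n m E, history X m E -> P (E `&` exits m.+2 n) <= rho%:E * P E.
Proof.
move=> v0 mv v1 Kv KKv n m E hE.
have hE1 := history_le (leqnSn m) hE.
have hE2 := history_le (leqnSn m.+1) hE1.
have Kv0 x : 0 <= \int[K x]_y v y by exact: integral_ge0.
have mKv := measurable_kernel_integral v0 mv.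
apply: le_trans (prob_exits_le v0 mv v1 Kv n hE2) _.
rewrite markov_chain_integral//.
rewrite (markov_chain_integral hE Kv0 mKv).
have mE := history_measurable mX hE.
rewrite -integral_cst//; apply: ge0_le_integral => //.
- by move=> w _; apply: integral_ge0 => y _; exact: Kv0.
- apply: measurable_funTS.
  exact: (measurableT_comp (measurable_kernel_integral Kv0 mKv) (mX m)).
Qed.

Lemma prob_limsup_exits0 (v : W -> \bar R) (rho : R) : (forall x, 0 <= v x) ->
    measurable_fun setT v -> (forall x, ~ G x -> 1 <= v x) ->
    (forall x, G x -> \int[K x]_y v y <= v x) ->
    (forall x, \int[K x]_y \int[K y]_z v z <= rho%:E) -> (0 <= rho < 1)%R ->
  P (\bigcap_m \bigcup_n exits m n) = 0.
Proof.
move=> v0 mv v1 Kv KKv /andP[rho0 rho1].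
pose B m := \bigcup_n exits m n; set L := \bigcap_m B m.
have mB m : measurable (B m).
  by apply: bigcup_measurable => n _; exact: measurable_exits.
have mL : measurable L by exact: bigcap_measurable.
(* L is approximated by E = exits m k, letting k and then m go to infinity. *)
have BL m E : history X m E -> P (E `&` L) <= rho%:E * P E.
  move=> hE; have mE := history_measurable mX hE.
  apply: (@le_trans _ _ (P (E `&` B m.+2))).
    apply: le_measure; rewrite ?inE; [exact: measurableI|exact: measurableI|].
    by apply: setIS => w; exact.
  rewrite /B setI_bigcupr.
  have mEe k : measurable (E `&` exits m.+2 k).
    by apply: measurableI => //; exact: measurable_exits.
  have cvgE : P \o (fun k => E `&` exits m.+2 k) @ \oo -->
      P (\bigcup_k (E `&` exits m.+2 k)).
    apply: nondecreasing_cvg_mu => //; first exact: bigcup_measurable.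
    by move=> k l kl; apply/subsetPset; apply: setIS; exact: subset_exits.
  apply: (cvge_le _ cvgE); apply: nearW => k /=.
  exact: (prob_exits2_le v0 mv v1 Kv KKv).
(* [BL] is used for [exits m k], known by time [m + k]; [L] is the increasing union of its traces on
   these events. *)
have LB m : P L <= rho%:E * P (B m).
  have -> : L = \bigcup_n (exits m n `&` L).
    by rewrite -setI_bigcupl setIC; apply/esym/setIidl => w; exact.
  have mEe k : measurable (exits m k `&` L).
    by apply: measurableI => //; exact: measurable_exits.
  have cvgE : P \o (fun k => exits m k `&` L) @ \oo -->
      P (\bigcup_k (exits m k `&` L)).
    apply: nondecreasing_cvg_mu => //; first exact: bigcup_measurable.
    by move=> k l kl; apply/subsetPset; apply: setSI; exact: subset_exits.
  apply: (cvge_le _ cvgE); apply: nearW => k /=.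
  apply: (@le_trans _ _ (rho%:E * P (exits m k))).
    by apply: (BL (m + k)%N); exact: exits_history.
  apply: lee_wpmul2l => //; apply: le_measure; rewrite ?inE//.
    exact: measurable_exits.
  exact: bigcup_sup.
have PL : P L <= rho%:E * P L.
  have PB : P \o B @ \oo --> P L.
    apply: nonincreasing_cvg_mu => //.
    - by rewrite (le_lt_trans (probability_le1 _ _))// ltry.
    (* [B] decreases: an exit at offset [i] from [l] is at offset [l - k + i] from [k]. *)
    - move=> k l kl; apply/subsetPset => w [n _ [i /= ? ?]].
      exists (l - k + n)%N => //; exists (l - k + i)%N; rewrite /= ?ltn_add2l//.
      by rewrite addnA subnKC.
  apply: (cvge_ge _ (cvgeZl _ PB)) => //.
  exact: nearW.
apply/eqP; rewrite eq_le measure_ge0 andbT.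
(* Finiteness moves the inequality to the reals, where [rho < 1] forces [P L] to vanish. *)
have PLfin : P L \is a fin_num by exact: fin_num_measure.
move: PL; rewrite -(fineK PLfin) -EFinM !lee_fin.
by rewrite -subr_le0 -{1}[fine _]mul1r -mulrBl pmulr_rle0// subr_gt0.
Qed.

(** Each step started in [G] contributes a factor [c]. The induction peels off time [m]: being in
    [G] at that time is absorbed into the event [E']. *)
Lemma integral_stay_le (g : W -> \bar R) (c : R) : (0 <= c)%R ->
    (forall x, 0 <= g x) -> measurable_fun setT g ->
    (forall x, G x -> \int[K x]_y g y <= c%:E * g x) ->
  forall n m E, history X m E ->
  \int[P]_(w in E `\` exits m n) g (X (m + n)%N w) <=
  (c ^+ n)%:E * \int[P]_(w in E) g (X m w).
Proof.
move=> c0 g0 mg Kg; elim=> [|n IHn] m E hE.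
  by rewrite exits0 setD0 addn0 mul1e.
have mE := history_measurable mX hE.
have mgX k D : measurable_fun D (g \o X k).
  by apply: measurable_funTS; exact: measurableT_comp.
set E' := E `&` X m @^-1` G.
have hE' : history X m E' by apply: historyI => //; exact: history_preimage.
have mE' := history_measurable mX hE'.
have -> : E `\` exits m n.+1 = E' `\` exits m.+1 n.
  by rewrite exitsS preimage_setC !setDE setCU setCK setIA.
rewrite -addSnnS; apply: le_trans (IHn _ _ (history_le (leqnSn m) hE')) _.
rewrite exprSr EFinM -muleA; apply: lee_wpmul2l; first by rewrite lee_fin exprn_ge0.
rewrite markov_chain_integral//.
apply: (@le_trans _ _ (\int[P]_(w in E') (c%:E * g (X m w)))).
  apply: ge0_le_integral => //.
  - by move=> w _; exact: integral_ge0.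
  - apply: measurable_funTS.
    exact: (measurableT_comp (measurable_kernel_integral g0 mg) (mX m)).
  - by apply: measurable_funeM; exact: mgX.
  - by move=> w [_]; exact: Kg.
rewrite ge0_integralZl_EFin//; last exact: mgX.
apply: lee_wpmul2l => //; apply: ge0_subset_integral => //; first exact: mgX.
exact: subIsetl.
Qed.

End markov.

(** * From conditions on the path space to conditions on the kernel *)

Section family.
Context d (Omega : measurableType d) d' (W : measurableType d') (R : realType).
Variables (K : R.-pker W ~> W) (X : nat -> Omega -> W).
Variable Pr : W -> probability Omega R.
Hypothesis HX : markov_family K Pr X.

Lemma markov_family_integral0 x (f : W -> \bar R) : (forall y, 0 <= f y) ->
  measurable_fun setT f -> \int[Pr x]_w f (X 0%N w) = f x.
Proof.
move=> f0 mf; have [[mX _] X0] := HX x.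
have -> : \int[Pr x]_w f (X 0%N w) = \int[Pr x]_w \int[\d_x]_y f y.
  (* The initial law is viewed as a disintegration with constant kernel [\d_x]. *)
  apply: (@integral_disintegration _ _ _ _ _ _ _ _ (fun=> \d_x)) => //.
  move=> B mB; rewrite setTI; apply: (eq_trans (X0 _ mB)).
  rewrite (_ : (fun=> _) = cst (\d_x B))// integral_cst//.
  by rewrite [X in _ * X]probability_setT mule1.
transitivity (\int[Pr x]_w cst (f x) w).
  by apply: eq_integral => w _; rewrite integral_dirac// diracT mul1e.
by rewrite integral_cst// [X in _ * X]probability_setT mule1.
Qed.

(** This rewrites (A) in terms of [K]; [markov_family_prob2] does the same for (D). *)
Lemma markov_family_integral1 x (f : W -> \bar R) : (forall y, 0 <= f y) ->
  measurable_fun setT f -> \int[Pr x]_w f (X 1%N w) = \int[K x]_y f y.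
Proof.
move=> f0 mf; have [HXx _] := HX x.
rewrite (markov_chain_integral HXx)//; last first.
  exact: (@history_preimage _ _ _ _ X 0%N 0%N setT).
rewrite (markov_family_integral0 x (f := fun z => \int[K z]_y f y))//.
  by move=> z; exact: integral_ge0.
exact: measurable_kernel_integral.
Qed.

Lemma markov_family_prob2 x B : measurable B ->
  Pr x (X 2%N @^-1` B) = \int[K x]_y K y B.
Proof.
move=> mB; have [[mX HXx] _] := HX x.
rewrite -[X in Pr x X]setTI HXx//; last first.
  exact: (@history_preimage _ _ _ _ X 0%N 1%N setT).
by rewrite (markov_family_integral1 x (f := K ^~ B))//; exact: measurable_kernel.
Qed.

End family.

(** * The truncated Lyapunov function *)

Section lyapunov.
Context d' (W : measurableType d') (R : realType) (K : R.-pker W ~> W).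
Variables (F G : set W) (g : W -> R) (b b' delta : R).
Hypothesis mF : measurable F.
Hypothesis mg : measurable_fun setT g.
Hypothesis g0 : forall x, (0 <= g x)%R.
Hypothesis b0 : (0 < b)%R.
Hypothesis b'b : (b' <= b)%R.
Hypothesis gG : forall x, G x -> \int[K x]_y (g y)%:E <= (g x)%:E.
Hypothesis gGC : forall x, ~ G x -> (b <= g x)%R.
Hypothesis gF : forall x, F x -> (g x <= b')%R.
Hypothesis FK : forall x, delta%:E <= \int[K x]_y K y F.

(** The cap keeps the integral against [K x] at most 1 at every [x], even outside [G], where (A)
    says nothing. *)
Definition truncated x : \bar R := (Num.min 1 (b^-1 * g x)%R)%:E.

Lemma truncated_ge0 x : 0 <= truncated x.
Proof. by rewrite lee_fin le_min ler01 mulr_ge0// invr_ge0 ltW. Qed.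

Lemma measurable_truncated : measurable_fun setT truncated.
Proof.
apply/measurable_EFinP; apply: measurable_minr => //.
exact: measurable_funM.
Qed.

Lemma truncated_ge1 x : ~ G x -> 1 <= truncated x.
Proof. by move=> /gGC bg; rewrite lee_fin le_min lexx/= ler_pdivlMl// mulr1. Qed.

Lemma integral_truncated_le1 x : \int[K x]_y truncated y <= 1.
Proof.
rewrite -[leRHS](prob_kernel (s := K) x) -[leRHS]mul1e -integral_cst//.
apply: ge0_le_integral => //; [|exact: measurable_truncated|].
- by move=> y _; exact: truncated_ge0.
- by move=> y _; rewrite lee_fin ge_min lexx.
Qed.

Lemma integral_truncated_le x : G x -> \int[K x]_y truncated y <= truncated x.
Proof.
move=> Gx; rewrite /truncated EFin_min le_min integral_truncated_le1/=.
apply: (@le_trans _ _ (\int[K x]_y ((b^-1)%:E * (g y)%:E))).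
  apply: ge0_le_integral => //.
  - by move=> y _; exact: truncated_ge0.
  - exact: measurable_truncated.
  - by apply: measurable_funeM; exact/measurable_EFinP.
  - by move=> y _; rewrite -EFinM lee_fin ge_min lexx orbT.
have ib : (0 <= b^-1)%R by rewrite invr_ge0 ltW.
rewrite ge0_integralZl_EFin//; first by rewrite EFinM lee_wpmul2l ?lee_fin ?gG.
- by move=> y _; rewrite lee_fin.
- exact/measurable_EFinP.
Qed.

Lemma integral2_truncated_le x :
  \int[K x]_y \int[K y]_z truncated z <= (1 - delta * (1 - b' / b))%:E.
Proof.
set p := (1 - b' / b)%R.
have p0 : (0 <= p)%R by rewrite subr_ge0 ler_pdivrMr// mul1r.
have KvF y : \int[K y]_z truncated z + p%:E * K y F <= 1.
  have -> : K y F = \int[K y]_z (\1_F z)%:E by rewrite integral_indic// setIT.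
  have m1F : measurable_fun setT (fun z => (\1_F z)%:E : \bar R) by exact/measurable_EFinP.
  have F0 z : 0 <= (\1_F z)%:E :> \bar R by rewrite lee_fin.
  rewrite -ge0_integralZl_EFin//.
  rewrite -ge0_integralD//; last 4 first.
  - by move=> z _; exact: truncated_ge0.
  - exact: measurable_truncated.
  - by move=> z _; rewrite mule_ge0.
  - exact: measurable_funeM.
  rewrite -[leRHS](prob_kernel (s := K) y) -[leRHS]mul1e -integral_cst//.
  apply: ge0_le_integral => //.
  - by move=> z _; rewrite adde_ge0 ?mule_ge0// truncated_ge0.
  - by apply: emeasurable_funD; [exact: measurable_truncated|exact: measurable_funeM].
  move=> z _; rewrite -EFinM -EFinD lee_fin indicE.
  (* Off [F] the cap suffices; on [F], [gF] bounds the truncation by [b' / b], which is [1 - p]. *)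
  have [|_] := boolP (z \in F); last by rewrite mulr0 addr0 ge_min lexx.
  rewrite inE mulr1 => /gF gz; rewrite /p addrCA gerDl subr_le0 ge_min.
  by rewrite [(b^-1 * _)%R]mulrC ler_pM2r ?invr_gt0// gz orbT.
have Kv0 y : 0 <= \int[K y]_z truncated z.
  by apply: integral_ge0 => z _; exact: truncated_ge0.
have mKv : measurable_fun setT (fun y => \int[K y]_z truncated z).
  by apply: measurable_kernel_integral; [exact: truncated_ge0|exact: measurable_truncated].
have mKF : measurable_fun setT (K ^~ F) by exact: measurable_kernel.
have : \int[K x]_y (\int[K y]_z truncated z + p%:E * K y F) <= 1.
  rewrite -[leRHS](prob_kernel (s := K) x) -[leRHS]mul1e -integral_cst//.
  apply: ge0_le_integral => //.
  - by move=> y _; rewrite adde_ge0 ?mule_ge0.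
  - by apply: emeasurable_funD => //; exact: measurable_funeM.
rewrite ge0_integralD//; last 2 first.
- by move=> y _; rewrite mule_ge0.
- exact: measurable_funeM.
rewrite ge0_integralZl_EFin// => le1.
rewrite EFinB leeBrDr// mulrC EFinM; apply: le_trans le1.
by rewrite leeD2l// lee_wpmul2l.
Qed.

End lyapunov.

(** The threshold [k] is there because [g (X m)] may fail to be integrable. Extended by zero off
    [D n], the [n]-th function has integral at most [k (theta c)^n], which is summable. *)
Lemma ae_cvg_stay d (Omega : measurableType d) d' (W : measurableType d')
    (R : realType) (K : R.-pker W ~> W) (P : probability Omega R)
    (X : nat -> Omega -> W) (G : set W) (g : W -> R) (c theta : R) m (k : R) :
  markov_chain K P X -> measurable G -> measurable_fun setT g ->
  (forall x, 0 <= g x)%R -> (0 <= c)%R -> (0 <= theta)%R -> (theta * c < 1)%R ->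
  (forall x, G x -> \int[K x]_y (g y)%:E <= (c * g x)%:E) -> (0 <= k)%R ->
  {ae P, forall w, (g (X m w) <= k)%R -> (forall n, ~ exits X G m n w) ->
    (theta ^+ n * g (X (m + n)%N w))%R @[n --> \oo] --> (0 : R)%R}.
Proof.
move=> HX mG mg g0 c0 theta0 thetac Kg k0.
have mX := HX.1.
have mgk : measurable [set x | (g x <= k)%R].
  by rewrite -[X in measurable X]setTI; exact: measurable_fun_le.
pose E := X m @^-1` [set x | (g x <= k)%R].
have hE : history X m E by exact: history_preimage.
have mE := history_measurable mX hE.
pose h n w := (theta ^+ n * g (X (m + n)%N w))%R.
have h0 n w : (0 <= h n w)%R by rewrite mulr_ge0// exprn_ge0.
have mgX n : measurable_fun setT (g \o X n) by exact: measurableT_comp.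
have mh n : measurable_fun setT (h n) by apply: measurable_funM => //; exact: mgX.
(* Never leaving [G] involves infinitely many times, so the [n]-th function is restricted only by
   the first [n] of them. A path of [E] that never leaves [G] lies in every [D n]. *)
pose D n := E `\` exits X G m n.
have mD n : measurable (D n).
  by apply: measurableD => //; exact: (measurable_exits HX).
have Kg' x : G x -> \int[K x]_y (EFin \o g) y <= c%:E * (EFin \o g) x.
  by move=> Gx; rewrite -EFinM; exact: Kg.
have hle n : \int[P]_w ((h n \_ (D n)) w)%:E <= (k * (theta * c) ^+ n)%:E.
  have -> : \int[P]_w ((h n \_ (D n)) w)%:E = \int[P]_(w in D n) (h n w)%:E.
    by rewrite [RHS]integral_mkcond restrict_EFin.
  under eq_integral do rewrite EFinM.
  rewrite ge0_integralZl_EFin ?exprn_ge0//; last 2 first.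
  - by move=> w _; rewrite lee_fin.
  - by apply: measurable_funTS; apply/measurable_EFinP; exact: mgX.
  rewrite exprMn_comm; last exact: mulrC.
  rewrite mulrCA EFinM; apply: lee_wpmul2l; first by rewrite lee_fin exprn_ge0.
  apply: le_trans (integral_stay_le HX mG c0 _ _ Kg' n hE) _.
  - by move=> x; rewrite lee_fin.
  - exact/measurable_EFinP.
  rewrite mulrC EFinM; apply: lee_wpmul2l; first by rewrite lee_fin exprn_ge0.
  apply: (@le_trans _ _ (k%:E * P E)).
    rewrite -integral_cst//; apply: ge0_le_integral => //.
    + by move=> w _; rewrite lee_fin.
    + by apply: measurable_funTS; apply/measurable_EFinP; exact: mgX.
  by rewrite -[leRHS]mule1; apply: lee_wpmul2l => //; exact: probability_le1.
have := ae_cvg0_geometric k0 _ _ _ hle.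
rewrite mulr_ge0//= => /(_ thetac).
have mhD n : measurable_fun setT (h n \_ (D n)).
  by apply/(measurable_restrictT _ _).1 => //; exact: measurable_funTS.
move=> /(_ mhD); have hD0 n w : (0 <= (h n \_ (D n)) w)%R by rewrite patchE; case: ifP.
move=> /(_ hD0); apply: filterS => w hw gk nex.
rewrite (_ : (fun _ => _) = (fun n => (h n \_ (D n)) w))//.
by apply/funext => n; rewrite patchE mem_set.
Qed.

(* The rate [theta] and the covering of almost every path *)
Local Close Scope ereal_scope.
Unset Implicit Arguments.

Theorem theorem2 (R : realType)
    (d : measure_display) (Omega : measurableType d)
    (d' : measure_display) (W : measurableType d')
    (K : R.-pker W ~> W) (X : nat -> Omega -> W)
    (Pr : W -> probability Omega R) (HX : markov_family K Pr X)
    (F G : set W) (mF : measurable F) (mG : measurable G) (FG : F `<=` G)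
    (g : W -> R) (mg : measurable_fun setT g) (g0 : forall x, 0 <= g x)
    (c delta b b' : R) (c0 : 0 <= c) (c1 : c < 1) (delta0 : 0 < delta)
    (HA : forall x, G x -> ('E_(Pr x)[g \o X 1%N] <= (c * g x)%:E)%E)
    (HB : forall x, (~` G) x -> b <= g x)
    (HC : forall x, F x -> g x <= b') (b'b : b' < b)
    (HD : forall x, (delta%:E <= Pr x (X 2%N @^-1` F))%E) :
  exists theta : R, 1 < theta /\
    forall P : probability Omega R, markov_chain K P X ->
      {ae P, forall w, (fun n : nat => theta ^+ n * g (X n w)) @ \oo --> (0 : R)}.
Proof.
have cp : 0 < 1 + c by rewrite ltr_pwDl.
(* The inverse of the midpoint of [c] and 1: both [theta > 1] and [theta c < 1] follow from [c < 1],
   and [c = 0] needs no separate case. *)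
exists (2 / (1 + c)); set theta := 2 / (1 + c).
have theta1 : 1 < theta by rewrite ltr_pdivlMr// mul1r -[ltRHS]/(1 + 1) ltrD2l.
have theta0 : 0 <= theta by rewrite (le_trans _ (ltW theta1)).
have thetac : theta * c < 1.
  by rewrite /theta mulrAC ltr_pdivrMr// mul1r mulr_natl mulr2n ltrD2r.
split => // P HP.
have gE0 y : (0 <= (g y)%:E)%E by rewrite lee_fin.
have mgE : measurable_fun setT (EFin \o g) by exact/measurable_EFinP.
(* (A) and (D) become properties of [K], and so are available under [P], whose initial law is
   arbitrary. *)
have Kg x : G x -> (\int[K x]_y (g y)%:E <= (c * g x)%:E)%E.
  move=> /HA; rewrite unlock.
  by rewrite -(markov_family_integral1 HX x (f := EFin \o g)).
have KF x : (delta%:E <= \int[K x]_y K y F)%E.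
  by rewrite -(markov_family_prob2 HX)//; exact: HD.
(* (D) makes [F] nonempty, whence [0 <= b' < b] and division by [b] is legitimate. *)
have [y Fy] : F !=set0.
  apply/set0P/eqP => F0; have := HD point.
  by rewrite F0 preimage_set0 measure0 lee_fin leNgt delta0.
have b'0 : 0 <= b' := le_trans (g0 y) (HC y Fy).
have b0 : 0 < b := le_lt_trans b'0 b'b.
have Kg1 x : G x -> (\int[K x]_y (g y)%:E <= (g x)%:E)%E.
  by move=> Gx; rewrite (le_trans (Kg _ Gx))// lee_fin ler_piMl// ltW.
(* This gives [rho >= 0] for [rho = 1 - delta (1 - b' / b)]. *)
have delta1 : delta <= 1.
  rewrite -lee_fin (le_trans (HD point))// probability_le1//.
  by rewrite -[X in measurable X]setTI; exact: (HX point).1.1.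
have PL : P (\bigcap_m \bigcup_n exits X G m n) = 0%E.
  apply: (prob_limsup_exits0 HP mG (v := truncated g b)).
  - by move=> x; exact: truncated_ge0.
  - exact: measurable_truncated.
  - by move=> x; exact: truncated_ge1.
  - by move=> x; exact: integral_truncated_le.
  - by move=> x; exact: (integral2_truncated_le mF mg g0 b0 (ltW b'b) HC KF).
  - have p0 : 0 < 1 - b' / b by rewrite subr_gt0 ltr_pdivrMr// mul1r.
    rewrite subr_ge0 gtrBl mulr_gt0// andbT mulr_ile1 ?(ltW delta0) ?(ltW p0)//.
    by rewrite gerBl divr_ge0// ltW.
have aeL : {ae P, forall w, ~ (\bigcap_m \bigcup_n exits X G m n) w}.
  exists (\bigcap_m \bigcup_n exits X G m n); split => //.
  - apply: bigcapT_measurable => m; apply: bigcup_measurable => n _.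
    exact: (measurable_exits HP).
  - by move=> w /= /contrapT.
have aeS m k := ae_cvg_stay m HP mG mg g0 c0 theta0 thetac Kg (ler0n R k).
(* Thresholds run over the naturals, so only countably many null sets are discarded. *)
have := ae_foralln (fun m => ae_foralln (aeS m)).
apply: filterS2 aeL => w nL cvgw.
have [m nex] : exists m, forall n, ~ exits X G m n w.
  apply: contrapT => /forallNP nm; apply: nL => m _.
  by have /existsNP[n /contrapT ?] := nm m; exists n.
rewrite -(cvg_shiftn m).
(* The threshold is a natural number above [g (X m w)]; the factor [theta ^+ m] then accounts for
   the time shift by [m]. *)
have := cvgw m (Num.truncn (g (X m w))).+1 (ltW (truncnS_gt _)) nex.
move=> /(cvgMl_tmp (a := theta ^+ m)).
rewrite mulr0.
rewrite (_ : (fun x => _) = [sequence theta ^+ (n + m) * g (X (n + m)%N w)]_n)//.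
by apply/funext => n /=; rewrite mulrA -exprD addnC.
Qed.
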